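(* Let $d\ge2$ and let $\boldsymbol{X}=(X_1,\dots,X_d)$ be a vector of positive random variables with joint cdf $F_{\boldsymbol{X}}(\boldsymbol{x})=C(F_{X_1}(x_1),\dots,F_{X_d}(x_d))$, $\boldsymbol{x}\in\mathbb{R}_+^d$, where $C\in\mathcal{C}_d^{FGM}$, and let $\boldsymbol{I}=(I_1,\dots,I_d)$ be a symmetric multivariate Bernoulli random vector representing $C$. Let $S=X_1+\dots+X_d$. For $m\in\{1,2,\dots\}$, assuming that $E[X_k^m]$ exists (is finite) for $k=1,\dots,d$, we have $$E[S^m]=\sum_{j_1+\cdots+j_d=m}\frac{m!}{j_1!\cdots j_d!}\left\{\prod_{k=1}^{d}E[X_k^{j_k}]\right\}E_{\boldsymbol{I}}\left[\prod_{k=1}^{d}\left\{1+(-1)^{I_k}\left(1-\frac{\mu_{X_{k,[2]}}^{(j_k)}}{E[X_k^{j_k}]}\right)\right\}\right],$$ where the sum runs over all $(j_1,\dots,j_d)$ of non-negative integers with $j_1+\cdots+j_d=m$.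
   Context: $\mathcal{C}_d^{FGM}$ is the class of $d$-variate Farlie-Gumbel-Morgenstern (FGM) copulas, that is, functions $$C(\boldsymbol{u})=\prod_{k=1}^d u_k\left(1+\sum_{k=2}^{d}\sum_{1\le j_1<\cdots<j_k\le d}\theta_{j_1\ldots j_k}\overline{u}_{j_1}\cdots\overline{u}_{j_k}\right),\quad \boldsymbol{u}\in[0,1]^d,\ \overline{u}_j=1-u_j,$$ whose real parameters satisfy $1+\sum_{k=2}^{d}\sum_{1\le j_1<\dots<j_k\le d}\theta_{j_1\dots j_k}\varepsilon_{j_1}\cdots\varepsilon_{j_k}\ge 0$ for all $(\varepsilon_1,\dots,\varepsilon_d)\in\{-1,1\}^d$. A symmetric multivariate Bernoulli random vector is a random vector $\boldsymbol{I}$ with values in $\{0,1\}^d$ such that $\Pr(I_k=0)=\Pr(I_k=1)=1/2$ for every $k$. It represents $C$ if $$C(\boldsymbol{u})=E_{\boldsymbol{I}}\left[\prod_{k=1}^d F_{U_{[I_k+1]}}(u_k)\right],\quad \boldsymbol{u}\in[0,1]^d,$$ where $F_{U_{[1]}}(u)=1-(1-u)^2$ and $F_{U_{[2]}}(u)=u^2$. It is known that every $C\in\mathcal{C}_d^{FGM}$ is represented by such a vector, and then $\theta_{j_1\ldots j_k}=(-2)^kE_{\boldsymbol{I}}\{\prod_{n=1}^k(I_{j_n}-\tfrac12)\}$. For each $k$, $X_{k,[2]}$ denotes a random variable distributed as the maximum of two independent copies of $X_k$, i.e. with cdf $F_{X_k}(x)^2$, and $\mu_{X_{k,[2]}}^{(j)}=E[X_{k,[2]}^{j}]$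 (with the value $1$ for $j=0$). $E_{\boldsymbol{I}}$ denotes expectation over $\boldsymbol{I}$. *)

(* Defs.v *)
From HB Require Import structures.
From mathcomp Require Import all_boot all_order all_algebra.
From mathcomp Require Import all_classical all_reals all_analysis.

Set Implicit Arguments.
Unset Strict Implicit.
Unset Printing Implicit Defensive.

Import Order.TTheory GRing.Theory Num.Theory.

Local Open Scope classical_set_scope.
Local Open Scope ring_scope.
Local Open Scope ereal_scope.

Section fgm_copula.
Context {R : realType} {d : nat}.

(* The increasing tuples j_1 < ... < j_k with 2 <= k <= d are encoded as the
   subsets J of 'I_d with at least two elements; the value of theta on smaller
   subsets is never used. *)
Definition fgm_sum (theta : {set 'I_d} -> R) (v : 'I_d -> R) : R :=
  (1 + \sum_(J : {set 'I_d} | (2 <= #|J|)%N) theta J * \prod_(j in J) v j)%R.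

Definition fgm_admissible (theta : {set 'I_d} -> R) : Prop :=
  forall eps : 'I_d -> R,
    (forall k, eps k = -1 \/ eps k = 1)%R -> (0 <= fgm_sum theta eps)%R.

Definition unit_cube : set ('I_d -> R) :=
  [set u | forall k, (0 <= u k <= 1)%R].

(* A copula is a function on the unit cube: values outside are irrelevant. *)
Definition is_fgm_copula (C : ('I_d -> R) -> R) : Prop :=
  exists2 theta : {set 'I_d} -> R, fgm_admissible theta &
    forall u, unit_cube u ->
      C u = (\prod_k u k * fgm_sum theta (fun j => 1 - u j))%R.

End fgm_copula.

Section bernoulli_representation.
Context {R : realType} {d : nat} {dQ : measure_display} {Q : measurableType dQ}.
Variable PQ : probability Q R.

(* The values 0 and 1 of I_k are encoded as false and true. *)
Definition symmetric_bernoulli (I : 'I_d -> {RV PQ >-> bool}) : Prop :=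
  forall k (b : bool), PQ [set w | I k w = b] = (2^-1)%:E.

(* F_{U_[b+1]}: the cdf of the minimum (b = 0) or of the maximum (b = 1) of two
   independent uniform variables on [0, 1], for arguments in [0, 1]. *)
Definition F_U (b : bool) (u : R) : R :=
  (if b then u ^+ 2 else 1 - (1 - u) ^+ 2)%R.

Definition represents (I : 'I_d -> {RV PQ >-> bool})
    (C : ('I_d -> R) -> R) : Prop :=
  forall u, unit_cube u ->
    (C u)%:E = 'E_PQ[fun w => (\prod_k F_U (I k w) (u k))%R].

End bernoulli_representation.

Definition moment {R : realType} {dT : measure_display} {T : measurableType dT}
    {P : probability T R} (X : {RV P >-> R}) (j : nat) : \bar R :=
  'E_P[fun t => (X t ^+ j)%R].

(* Y has the law of the maximum of two independent copies of X. *)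
Definition max_of_two_copies {R : realType}
    {dT : measure_display} {T : measurableType dT} {P : probability T R}
    {dT' : measure_display} {T' : measurableType dT'} {P' : probability T' R}
    (X : {RV P >-> R}) (Y : {RV P' >-> R}) : Prop :=
  forall x, cdf Y x = (cdf X x) ^+ 2.

(* Main.v *)
Require Import Defs.
From HB Require Import structures.
From mathcomp Require Import all_boot all_order all_algebra.
From mathcomp Require Import all_classical all_reals all_analysis.
From mathcomp Require Import measurable_realfun.
From mathcomp Require Import ring.

(** Why the formula holds.

    By the multinomial theorem, [E(S^m)] is a combination of the mixed moments
    [E(X_1^j_1 ... X_d^j_d)], so everything rests on computing the expectation
    of a product [g_1(X_1) ... g_d(X_d)] of nonnegative functions.

    The representation of the copula says that the joint cdf of [X] is
    [E_I(prod_k F_(U_[I_k+1])(F_(X_k)(x_k)))].  Now [u^2] and [1-(1-u)^2],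
    composed with [F_(X_k)], are the cdfs of the maximum and of the minimum of
    two independent copies of [X_k]: conditionally on [I], the vector [X]
    behaves as if its coordinates were independent, the [k]-th one being the
    maximum or the minimum according to [I_k].  In terms of expectations
    (lemma [integral_prod_mixture]),
      [E(prod_k g_k(X_k)) = E_I(prod_k E(g_k(W_k,I_k)))],
    where [W_k,b] is that maximum ([b = 1]) or minimum ([b = 0]).

    The hypothesis is the case where every [g_k] is the indicator of a
    half-line.  The half-lines are replaced by arbitrary functions one
    coordinate at a time: with the other factors fixed, both sides are the
    integral of [g_k] against a measure on the line, the law of a random
    variable weighted by the product of the other factors, and finite measures
    that agree on the half-lines are equal
    ([ge0_integral_half_lines_unique]).

    It remains to identify the factors.  Since [max(x,y)] and [min(x,y)] are
    [x] and [y] in some order, [E(g(W_k,1)) + E(g(W_k,0)) = 2 E(g(X_k))]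
    ([ge0_integral_order_stat]).  For [g(x) = x^j] this gives [mu] for the
    maximum and [2 E(X_k^j) - mu] for the minimum, with [mu] the [j]-th moment
    of the maximum: in both cases
    [E(X_k^j) (1 + (-1)^b (1 - mu / E(X_k^j)))]. *)

Import Order.TTheory GRing.Theory Num.Theory.

Local Open Scope classical_set_scope.
Local Open Scope ring_scope.
Local Open Scope ereal_scope.

(** * The multinomial formula *)

Section multinomial.
Context {F : numFieldType} {I : finType}.
Local Open Scope ring_scope.

(** Both sides, divided by [m!], are the coefficient of degree [m] in the product
    over [i] of the exponential series of [a i * 'X] truncated after degree [m].
    Truncating at [m] makes the expansion of the product range over exactly the
    exponents bounded by [m]. *)
Lemma exprn_sum_multinomial (a : I -> F) (m : nat) :
  (\sum_i a i) ^+ m =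
  \sum_(j : {ffun I -> 'I_m.+1} | (\sum_i j i == m)%N)
     m`!%:R / (\prod_i (j i)`!%:R) * \prod_i a i ^+ j i.
Proof.
have fact_neq0 n : n`!%:R != 0 :> F by rewrite pnatr_eq0 -lt0n fact_gt0.
pose e i : {poly F} := \poly_(k < m.+1) (a i ^+ k / k`!%:R).
have coef_e (s : seq I) n : (n <= m)%N ->
    (\prod_(i <- s) e i)`_n = (\sum_(i <- s) a i) ^+ n / n`!%:R.
  elim: s n => [|i s IHs] n nm.
    by rewrite !big_nil coef1 expr0n; case: n {nm} => [|n]; rewrite ?mul0r// divr1.
  rewrite !big_cons coefM addrC exprDn mulr_suml; apply: eq_bigr => k _.
  have kn : (k <= n)%N by rewrite -ltnS.
  rewrite coef_poly ltnS (leq_trans kn nm) IHs ?(leq_trans (leq_subr _ _) nm)//.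
  rewrite -(bin_fact kn) !natrM -mulr_natr.
  by field; rewrite !fact_neq0 pnatr_eq0 -lt0n bin_gt0 kn.
have := coef_e (index_enum I) m (leqnn m) => /(congr1 ( *%R^~ m`!%:R)).
rewrite divfK// => <-.
under eq_bigr => i _ do rewrite /e poly_def.
rewrite bigA_distr_bigA/= coef_sum mulr_suml [RHS]big_mkcond/=.
apply: eq_bigr => j _.
rewrite scaler_prod -expr_sum coefZ coefXn eq_sym.
case: ifPn => _; last by rewrite mulr0 mul0r.
rewrite mulr1 prodf_div; ring.
Qed.

End multinomial.

(** * Integrals determined by half-lines *)

Section half_lines.
Context {R : realType}.

Lemma measurable_half_linesE :
  @measurable _ R = <<s [set A : set R | exists x, A = `]-oo, x]%classic] >>.
Proof.
rewrite [LHS]RGenOInfty.measurableE; apply/seteqP; split.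
- apply: smallest_sub; first exact: smallest_sigma_algebra.
  move=> A [x ->]; rewrite -setCitvl -setTD; apply: sigma_algebraCD.
  by apply: sub_sigma_algebra => /=; exists x.
- apply: smallest_sub; first exact: smallest_sigma_algebra.
  move=> A [x ->]; rewrite -setCitvr -setTD; apply: sigma_algebraCD.
  by apply: sub_sigma_algebra => /=; exists x.
Qed.

Lemma measure_half_lines_unique (m1 m2 : {measure set R -> \bar R}) :
  (forall x, m1 `]-oo, x]%classic = m2 `]-oo, x]%classic) ->
  (forall x, m1 `]-oo, x]%classic < +oo) ->
  forall A, measurable A -> m1 A = m2 A.
Proof.
move=> m12 m1oo A; apply: (measure_unique _ (fun n => `]-oo, n%:R]%classic : set R)).
- exact: measurable_half_linesE.
- move=> _ _ [x ->] [y ->]; exists (Num.min x y).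
  apply/seteqP; split => z /=; rewrite !in_itv/= le_min.
    by move=> [-> ->].
  by move=> /andP[].
- by move=> n; exists n%:R.
- apply/seteqP; split => // x _.
  by exists (Num.truncn x).+1 => //=; rewrite in_itv/= ltW// truncnS_gt.
- by move=> _ [x ->].
- by [].
Qed.

End half_lines.

Lemma integral_half_line d (T : measurableType d) (R : realType)
    (P : probability T R) (X : {RV P >-> R}) x :
  \int[P]_t (\1_(`]-oo, x]%classic) (X t))%:E = cdf X x.
Proof.
pose A := X @^-1` `]-oo, x]%classic.
have mA : measurable A by exact: measurable_funPTI.
transitivity (\int[P]_t (\1_A t)%:E); first exact: eq_integral.
by rewrite integral_indic// setIT.
Qed.

Section weighted_law.
Context d d' (T : measurableType d) (T' : measurableType d') (R : realType).
Variables (mu : {measure set T -> \bar R}) (Z : T -> T') (G : T -> R).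
Hypotheses (mZ : measurable_fun setT Z) (mG : measurable_fun setT G).
Hypothesis G0 : forall t, (0 <= G t)%R.

(** The image under [Z] of the measure of density [G] with respect to [mu]. *)
Definition weighted_law (A : set T') : \bar R :=
  \int[mu]_(t in Z @^-1` A) (G t)%:E.

Let weighted_law0 : weighted_law set0 = 0.
Proof. by rewrite /weighted_law preimage_set0 integral_set0. Qed.

Let weighted_law_ge0 A : 0 <= weighted_law A.
Proof. by apply: integral_ge0 => t _; rewrite lee_fin. Qed.

Let mZpre A : measurable A -> measurable (Z @^-1` A).
Proof. by move=> mA; rewrite -[_ @^-1` _]setTI; exact: mZ. Qed.

Let weighted_law_sigma_additive : semi_sigma_additive weighted_law.
Proof.
move=> F mF tF mUF; rewrite /weighted_law preimage_bigcup ge0_integral_bigcup.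
- apply: is_cvg_nneseries => n _ _.
  by apply: integral_ge0 => t _; rewrite lee_fin.
- by move=> n; exact: mZpre.
- exact/measurable_EFinP/measurable_funTS.
- by move=> t _; rewrite lee_fin.
- apply/trivIsetP => i j _ _ ij; rewrite -preimage_setI.
  by move/trivIsetP : tF => /(_ _ _ _ _ ij) ->//; rewrite preimage_set0.
Qed.

HB.instance Definition _ := isMeasure.Build _ _ _ weighted_law
  weighted_law0 weighted_law_ge0 weighted_law_sigma_additive.

Import HBNNSimple.

Let integral_weighted_law_nnsfun (f : {nnsfun T' >-> R}) :
  \int[weighted_law]_y (f y)%:E = \int[mu]_t (f (Z t) * G t)%:E.
Proof.
under [LHS]eq_integral do rewrite fimfunE -fsumEFin//.
rewrite [LHS]ge0_integral_fsum//; last 2 first.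
- by move=> r; exact/measurable_EFinP/measurableT_comp.
- by move=> n x _; rewrite EFinM nnfun_muleindic_ge0.
under [RHS]eq_integral.
  move=> t _; rewrite EFinM fimfunE -fsumEFin// ge0_mule_fsuml; last first.
    by move=> r; rewrite EFinM nnfun_muleindic_ge0.
  over.
have m1 r : measurable_fun setT (fun t => (\1_(f @^-1` [set r]) (Z t) : R)).
  exact: measurableT_comp.
rewrite [RHS]ge0_integral_fsum//; last 2 first.
- move=> r; apply: emeasurable_funM; apply/measurable_EFinP => //.
  exact: measurable_funM.
- by move=> n x _; rewrite mule_ge0 ?lee_fin// -lee_fin EFinM nnfun_muleindic_ge0.
apply: eq_fsbigr => r /set_mem[x _ <-].
under [RHS]eq_integral do rewrite EFinM -muleA.
rewrite integralZl_indic_nnsfun// ge0_integralZl//.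
- congr (_ * _); rewrite integral_indic// setIT /= /weighted_law.
  rewrite integral_mkcond; apply: eq_integral => t _.
  rewrite patchE indicE; case: ifPn => [/set_mem tA|/negP tA].
    by rewrite mem_set// mul1e.
  by rewrite memNset ?mul0e// => tA'; apply: tA; exact/mem_set.
- by apply: emeasurable_funM; apply/measurable_EFinP.
- by move=> t _; rewrite mule_ge0 ?lee_fin.
- by rewrite lee_fin.
Qed.

(** Change of variables, from simple functions by monotone convergence. *)
Lemma ge0_integral_weighted_law (f : T' -> \bar R) :
  measurable_fun setT f -> (forall y, 0 <= f y) ->
  \int[weighted_law]_y f y = \int[mu]_t (f (Z t) * (G t)%:E).
Proof.
move=> mf f0.
pose f_ := nnsfun_approx measurableT mf.
have ndf n p y : (n <= p)%N -> (f_ n y <= f_ p y)%R.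
  by move=> np; exact/lefP/nd_nnsfun_approx.
have cvf y : (f_ n y)%:E @[n --> \oo] --> f y by exact: cvg_nnsfun_approx.
transitivity (lim (\int[weighted_law]_x (f_ n x)%:E @[n --> \oo])%E).
  rewrite -monotone_convergence//=.
  - by apply: eq_integral => t _; exact/esym/cvg_lim.
  - by move=> n; exact/measurable_EFinP.
  - by move=> n ? _; rewrite lee_fin.
  - by move=> ? _ ? ? mn; rewrite lee_fin ndf.
transitivity (lim (\int[mu]_t (f_ n (Z t) * G t)%:E @[n --> \oo])%E).
  by apply: congr_lim; apply/funext => n; exact: integral_weighted_law_nnsfun.
rewrite -monotone_convergence//=.
- apply: eq_integral => t _; apply/cvg_lim => //.
  under eq_fun do rewrite EFinM.
  exact: cvgeZr.
- move=> n; apply/measurable_EFinP; apply: measurable_funM => //.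
  exact: measurableT_comp.
- by move=> n ? _; rewrite lee_fin mulr_ge0.
- by move=> t _ n p np; rewrite lee_fin ler_wpM2r ?ndf.
Qed.

End weighted_law.

Arguments weighted_law {d d' T T' R}.

(** The integrals of [g (Z t) * G t] and [g (Z' t) * G' t] are those of [g]
    against two weighted laws; these are finite measures that agree on the
    half-lines, which are stable under intersection and generate the Borel
    sets. *)
Lemma ge0_integral_half_lines_unique (R : realType)
  d (T : measurableType d) (mu : {measure set T -> \bar R}) (Z G : T -> R)
  d' (T' : measurableType d') (mu' : {measure set T' -> \bar R}) (Z' G' : T' -> R) :
  measurable_fun setT Z -> measurable_fun setT G -> (forall t, (0 <= G t)%R) ->
  measurable_fun setT Z' -> measurable_fun setT G' -> (forall t, (0 <= G' t)%R) ->
  (forall x, \int[mu]_t (\1_(`]-oo, x]%classic) (Z t) * G t)%:E =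
             \int[mu']_t (\1_(`]-oo, x]%classic) (Z' t) * G' t)%:E) ->
  (forall x, \int[mu]_t (\1_(`]-oo, x]%classic) (Z t) * G t)%:E < +oo) ->
  forall g : R -> R, measurable_fun setT g -> (forall y, 0 <= g y)%R ->
  \int[mu]_t (g (Z t) * G t)%:E = \int[mu']_t (g (Z' t) * G' t)%:E.
Proof.
move=> mZ mG G0 mZ' mG' G'0 eqh hoo g mg g0.
have mEg : measurable_fun setT (EFin \o g) by exact/measurable_EFinP.
transitivity (\int[weighted_law mu Z G]_y (g y)%:E).
  by rewrite ge0_integral_weighted_law.
transitivity (\int[weighted_law mu' Z' G']_y (g y)%:E); last first.
  by rewrite ge0_integral_weighted_law.
have halfE d1 (T1 : measurableType d1) (m1 : {measure set T1 -> \bar R})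
    (Z1 G1 : T1 -> R) x : weighted_law m1 Z1 G1 `]-oo, x]%classic =
    \int[m1]_t (\1_(`]-oo, x]%classic) (Z1 t) * G1 t)%:E.
  rewrite /weighted_law integral_mkcond; apply: eq_integral => t _.
  rewrite patchE indicE; case: ifPn => [/set_mem tA|/negP tA].
    by rewrite mem_set// mul1r.
  by rewrite memNset ?mul0r// => tA'; apply: tA; exact/mem_set.
pose m : {measure set R -> \bar R} := weighted_law mu Z G.
pose m' : {measure set R -> \bar R} := weighted_law mu' Z' G'.
apply: (@eq_measure_integral _ _ _ setT (m' mZ' mG' G'0) (m mZ mG G0)) => A mA _.
apply: measure_half_lines_unique => // x.
  by rewrite /= !halfE eqh.
by rewrite /= halfE.
Qed.

(** * Maximum and minimum of two independent copies *)

Section order_statistics.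
Context {d} {T : measurableType d} {R : realType} (P : probability T R).

(** The boolean follows the convention of [F_U]: [true] selects the maximum. *)
Definition order_stat (X : T -> R) (b : bool) (p : T * T) : R :=
  if b then Num.max (X p.1) (X p.2) else Num.min (X p.1) (X p.2).

Lemma measurable_order_stat (X : T -> R) b :
  measurable_fun setT X -> measurable_fun setT (order_stat X b).
Proof.
move=> mX; have mX1 : measurable_fun setT (fun p : T * T => X p.1).
  exact: measurableT_comp.
have mX2 : measurable_fun setT (fun p : T * T => X p.2).
  exact: measurableT_comp.
case: b; [exact: measurable_maxr|exact: measurable_minr].
Qed.

(** The maximum and the minimum are the two copies in some order, so that their
    images by [g] have the same sum. *)
Lemma ge0_integral_order_stat (X : T -> R) (g : R -> R) :
  measurable_fun setT X -> measurable_fun setT g -> (forall x, 0 <= g x)%R ->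
  \int[P \x P]_p (g (order_stat X true p))%:E +
  \int[P \x P]_p (g (order_stat X false p))%:E =
  \int[P]_t (g (X t))%:E + \int[P]_t (g (X t))%:E.
Proof.
move=> mX mg g0.
have mgX : measurable_fun setT (fun t => (g (X t))%:E).
  by apply/measurable_EFinP; exact: measurableT_comp.
have mo b : measurable_fun setT (fun p => (g (order_stat X b p))%:E).
  apply/measurable_EFinP; apply: measurableT_comp => //.
  exact: measurable_order_stat.
have mg1 : measurable_fun setT (fun p : T * T => (g (X p.1))%:E).
  by apply: (measurableT_comp mgX); exact: measurable_fst.
have mg2 : measurable_fun setT (fun p : T * T => (g (X p.2))%:E).
  by apply: (measurableT_comp mgX); exact: measurable_snd.
rewrite -ge0_integralD//; try by move=> p _; rewrite lee_fin.
transitivity (\int[P \x P]_p ((g (X p.1))%:E + (g (X p.2))%:E)).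
  apply: eq_integral => p _; rewrite /order_stat.
  by case: (leP (X p.1) (X p.2)) => // _; rewrite addeC.
rewrite ge0_integralD//; try by move=> p _; rewrite lee_fin.
rewrite (fubini_tonelli1 (fun p : T * T => (g (X p.1))%:E))//=; last first.
  by move=> p; rewrite lee_fin.
rewrite (fubini_tonelli2 (fun p : T * T => (g (X p.2))%:E))//=; last first.
  by move=> p; rewrite lee_fin.
congr (_ + _); apply: eq_integral => t _; rewrite /fubini_F /fubini_G/=.
  by rewrite integral_cst//= probability_setT mule1.
by rewrite integral_cst//= probability_setT mule1.
Qed.

(** The maximum is at most [x] when both copies are, whence the square of the cdf;
    the cdf of the minimum follows from [ge0_integral_order_stat], as
    [2u - u^2 = 1 - (1-u)^2]. *)
Lemma integral_order_stat_half_line (X : {RV P >-> R}) b x :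
  \int[P \x P]_p (\1_(`]-oo, x]%classic) (order_stat X b p))%:E =
  (F_U b (fine (cdf X x)))%:E.
Proof.
have hmax : \int[P \x P]_p (\1_(`]-oo, x]%classic) (order_stat X true p))%:E =
    (fine (cdf X x) ^+ 2)%:E.
  pose A := X @^-1` `]-oo, x]%classic.
  have mA : measurable A by exact: measurable_funPTI.
  rewrite (eq_integral (fun p => (\1_(A `*` A) p)%:E)).
    rewrite integral_indic// ?setIT; last exact: measurableX.
    rewrite /= product_measure1E//= expr2 EFinM fineK//.
    by rewrite fin_num_measure.
  move=> p _; rewrite !indicE; congr ((nat_of_bool _)%:R%:E).
  apply/idP/idP => /set_mem; rewrite /= /order_stat /A /= !in_itv/= ?ge_max.
    by move=> /andP[? ?]; apply/mem_set; rewrite /= !in_itv.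
  move=> [? ?]; apply/mem_set; rewrite /= in_itv/= ge_max; exact/andP.
case: b => //.
have mh : measurable_fun setT (\1_(`]-oo, x]%classic) : R -> R).
  exact: measurable_indic.
have := ge0_integral_order_stat X _ (@measurable_funPT _ _ _ _ X) mh.
have -> : \int[P]_t (\1_(`]-oo, x]%classic) (X t))%:E = (fine (cdf X x))%:E.
  by rewrite integral_half_line fineK// fin_num_measure.
rewrite hmax => /(_ (fun=> ler0n _ _)).
move=> /(congr1 (fun z => z - (fine (cdf X x) ^+ 2)%:E)).
rewrite [X in X - _]addeC addeK// => ->.
by rewrite -!EFinD /F_U; congr EFin; ring.
Qed.

End order_statistics.

(** * Expectation of a product as a mixture *)

Lemma measurable_prodr_cond d (T : measurableType d) (R : realType)
    (J : finType) (S : pred J) (h : J -> T -> R) :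
  (forall k, S k -> measurable_fun setT (h k)) ->
  measurable_fun setT (fun t => \prod_(k | S k) h k t)%R.
Proof.
move=> mh; under eq_fun do rewrite -big_filter.
by apply: measurable_prod => k; rewrite mem_filter => /andP[/mh].
Qed.

Lemma measurable_orthant d (T : measurableType d) (R : realType)
    (J : finType) (h : J -> T -> R) (x : J -> R) :
  (forall k, measurable_fun setT (h k)) ->
  measurable [set t | forall k, (h k t <= x k)%R].
Proof.
move=> mh; have -> : [set t | forall k, (h k t <= x k)%R] =
    \big[setI/setT]_(k : J) (h k @^-1` `]-oo, x k]%classic).
  rewrite -bigcap_seq; apply/seteqP; split=> t /= ht k; last first.
    by have := ht k; rewrite /= in_itv/= mem_index_enum; exact.
  by move=> _; rewrite /= in_itv/=.
apply: bigsetI_measurable => k _.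
by rewrite -[_ @^-1` _]setTI; exact: mh.
Qed.

Section mixture.
Context {d : nat} {dT : measure_display} {T : measurableType dT} {R : realType}.
Context {P : probability T R} (X : 'I_d -> {RV P >-> R}).
Context {dQ : measure_display} {Q : measurableType dQ} {PQ : probability Q R}.
Context (I : 'I_d -> {RV PQ >-> bool}).

(** Real-valued, so that the products over the coordinates are taken in [R]; it
    is the actual mean when [g] is nonnegative and integrable, by
    [order_stat_meanE]. *)
Definition order_stat_mean (k : 'I_d) (b : bool) (g : R -> R) : R :=
  fine (\int[P \x P]_p (g (order_stat (X k) b p))%:E).

Let M := order_stat_mean.

Lemma integral_order_stat_lty (k : 'I_d) b (g : R -> R) :
  measurable_fun setT g -> (forall x, 0 <= g x)%R ->
  \int[P]_t (g (X k t))%:E < +oo ->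
  \int[P \x P]_p (g (order_stat (X k) b p))%:E < +oo.
Proof.
move=> mg g0 goo.
have := @ge0_integral_order_stat _ _ _ P (X k) g (@measurable_funPT _ _ _ _ (X k)) mg g0.
have i0 c : 0 <= \int[P \x P]_p (g (order_stat (X k) c p))%:E.
  by apply: integral_ge0 => p _; rewrite lee_fin.
move=> e; apply: (@le_lt_trans _ _
  (\int[P]_t (g (X k t))%:E + \int[P]_t (g (X k t))%:E)).
  by rewrite -e; case: b; [rewrite leeDl|rewrite leeDr].
by rewrite lte_add_pinfty.
Qed.

Lemma order_stat_meanE (k : 'I_d) b (g : R -> R) :
  measurable_fun setT g -> (forall x, 0 <= g x)%R ->
  \int[P]_t (g (X k t))%:E < +oo ->
  (M k b g)%:E = \int[P \x P]_p (g (order_stat (X k) b p))%:E.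
Proof.
move=> mg g0 goo; rewrite /M /order_stat_mean fineK// ge0_fin_numE.
  exact: integral_order_stat_lty.
by apply: integral_ge0 => p _; rewrite lee_fin.
Qed.

Lemma order_stat_mean_ge0 (k : 'I_d) b (g : R -> R) :
  (forall x, 0 <= g x)%R -> (0 <= M k b g)%R.
Proof. by move=> g0; apply: fine_ge0; apply: integral_ge0 => p _; rewrite lee_fin. Qed.

Lemma measurable_prod_bernoulli (S : pred 'I_d) (f : 'I_d -> bool -> R) :
  measurable_fun setT (fun w => \prod_(k | S k) f k (I k w))%R.
Proof.
apply: measurable_prodr_cond => k _.
by apply: (@measurableT_comp _ _ _ _ _ _ (f k)) => //.
Qed.

(** A product of functions of Bernoulli variables takes finitely many values. *)
Lemma integral_prod_bernoulli_lty (f : 'I_d -> bool -> R) :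
  (forall k b, 0 <= f k b)%R ->
  \int[PQ]_w (\prod_k f k (I k w))%:E < +oo.
Proof.
move=> f0; apply: (@le_lt_trans _ _ (\int[PQ]_w (\prod_k (f k true + f k false))%:E)).
  apply: ge0_le_integral => //.
  - by move=> w _; rewrite lee_fin prodr_ge0.
  - by apply/measurable_EFinP; exact: measurable_prod_bernoulli.
  - move=> w _; rewrite lee_fin; apply: ler_prod => k _.
    by rewrite f0/=; case: (I k w); rewrite ?lerDl ?lerDr.
by rewrite integral_cst//= probability_setT mule1 ltry.
Qed.

Let replace_at (g : 'I_d -> R -> R) (i : 'I_d) (h : R -> R) (k : 'I_d) : R -> R :=
  if k == i then h else g k.

Hypothesis half_lines_mixture : forall x : 'I_d -> R,
  P [set t | forall k, (X k t <= x k)%R] =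
  \int[PQ]_w (\prod_k F_U (I k w) (fine (cdf (X k) (x k))))%:E.

Let tame (k : 'I_d) (h : R -> R) := [/\ measurable_fun setT h,
  (forall y, 0 <= h y)%R & \int[P]_t (h (X k t))%:E < +oo].

Let tame_half_line k x : tame k (\1_(`]-oo, x]%classic)).
Proof.
split; first exact: measurable_indic.
  by move=> y; rewrite ler0n.
apply: (@le_lt_trans _ _ (\int[P]_t (cst 1 t))).
  apply: ge0_le_integral => //.
  - by apply/measurable_EFinP; apply: measurableT_comp.
  - by move=> t _; rewrite lee_fin indicE lern1 leq_b1.
by rewrite integral_cst//= probability_setT mule1 ltry.
Qed.

Let mixture_half_lines (x : 'I_d -> R) :
  \int[P]_t (\prod_k \1_(`]-oo, x k]%classic) (X k t))%:E =
  \int[PQ]_w (\prod_k M k (I k w) (\1_(`]-oo, x k]%classic)))%:E.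
Proof.
transitivity (P [set t | forall k, (X k t <= x k)%R]); last first.
  rewrite half_lines_mixture; apply: eq_integral => w _; congr EFin.
  apply: eq_bigr => k _; rewrite /M /order_stat_mean.
  by rewrite integral_order_stat_half_line.
set E := [set t | _].
have mE : measurable E by exact: measurable_orthant.
transitivity (\int[P]_t (\1_E t)%:E); last by rewrite integral_indic// setIT.
apply: eq_integral => t _; congr EFin.
rewrite indicE; case: (boolP (t \in E)) => [/set_mem tE|tE].
  by rewrite big1// => k _; rewrite indicE mem_set//= in_itv/=.
have [k xk] : exists k, (x k < X k t)%R.
  apply: contrapT => H; move/negP : tE; apply; apply/mem_set => k /=.
  by rewrite leNgt; apply/negP => xk; apply: H; exists k.
rewrite (bigD1 k)//= indicE memNset ?mul0r//= in_itv/= => /le_lt_trans/(_ xk).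
by rewrite ltxx.
Qed.

(** The products of the factors of index [k != i] are used as weights ([G] and [G']
    below).  The left side then integrates [g i] against the weighted law of [X i],
    the right side against the weighted law of the order statistic of [X i]
    selected by [I i], which lives on the product of the space of [I] and of two
    copies of the space of [X]. *)
Let mixture_step (i : 'I_d) (g : 'I_d -> R -> R) :
  (forall k, tame k (g k)) ->
  (forall x, \int[P]_t (\prod_k replace_at g i (\1_(`]-oo, x]%classic)) k (X k t))%:E =
    \int[PQ]_w (\prod_k M k (I k w) (replace_at g i (\1_(`]-oo, x]%classic)) k))%:E) ->
  \int[P]_t (\prod_k g k (X k t))%:E =
  \int[PQ]_w (\prod_k M k (I k w) (g k))%:E.
Proof.
move=> tg IH.
pose G t := (\prod_(k | k != i) g k (X k t))%R.
pose G' w := (\prod_(k | k != i) M k (I k w) (g k))%R.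
have lhsE h : \int[P]_t (\prod_k replace_at g i h k (X k t))%:E =
    \int[P]_t (h (X i t) * G t)%:E.
  apply: eq_integral => t _; congr EFin; rewrite (bigD1 i)//= /replace_at eqxx.
  by congr (_ * _)%R; apply: eq_bigr => k /negbTE ->.
have G0 t : (0 <= G t)%R.
  by apply: prodr_ge0 => k _; have [_ + _] := tg k; exact.
have G'0 w : (0 <= G' w)%R.
  by apply: prodr_ge0 => k _; apply: order_stat_mean_ge0; have [_ + _] := tg k.
have mG : measurable_fun setT G.
  apply: measurable_prodr_cond => k _; apply: measurableT_comp => //.
  by have [+ _ _] := tg k.
have mG' : measurable_fun setT G'.
  exact: (measurable_prod_bernoulli _ (fun k b => M k b (g k))).
pose Z (q : Q * (T * T)) := order_stat (X i) (I i q.1) q.2.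
have mZ : measurable_fun setT Z.
  apply: measurable_fun_ifT.
  - by apply: measurableT_comp => //; exact: measurable_fst.
  - by apply: (measurableT_comp (measurable_order_stat (X i) true _)) => //;
      exact: measurable_snd.
  - by apply: (measurableT_comp (measurable_order_stat (X i) false _)) => //;
      exact: measurable_snd.
pose PP : probability (T * T)%type R := P \x P.
have rhsE h : tame i h -> \int[PQ]_w (\prod_k M k (I k w) (replace_at g i h k))%:E =
    \int[PQ \x (P \x P)]_q (h (Z q) * G' q.1)%:E.
  move=> [mh h0 hoo].
  rewrite (@fubini_tonelli1 _ _ _ _ R PQ PP (fun q => (h (Z q) * G' q.1)%:E))/=.
  - apply: eq_integral => w _; rewrite /fubini_F /Z/=.
    under [RHS]eq_integral do rewrite EFinM.
    rewrite ge0_integralZr//.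
    + rewrite -order_stat_meanE// -EFinM; congr EFin.
      rewrite (bigD1 i)//= /replace_at eqxx; congr (_ * _)%R.
      by apply: eq_bigr => k /negbTE ->.
    + apply/measurable_EFinP; apply: measurableT_comp => //.
      exact: measurable_order_stat.
    + by move=> p _; rewrite lee_fin.
    + by rewrite lee_fin.
  - apply/measurable_EFinP; apply: measurable_funM.
      exact: measurableT_comp.
    by apply: measurableT_comp => //; exact: measurable_fst.
  - by move=> q; rewrite lee_fin mulr_ge0.
have updg k h : replace_at g i (g i) k h = g k h by rewrite /replace_at; case: eqP => // ->.
transitivity (\int[P]_t (\prod_k replace_at g i (g i) k (X k t))%:E).
  by apply: eq_integral => t _; congr EFin; apply: eq_bigr => k _; rewrite updg.
transitivity (\int[PQ]_w (\prod_k M k (I k w) (replace_at g i (g i) k))%:E); last first.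
  apply: eq_integral => t _; congr EFin; apply: eq_bigr => k _; congr M.
  by apply/funext => h; rewrite updg.
rewrite lhsE rhsE//; have [mgi gi0 _] := tg i.
pose PQPP : {measure set (Q * (T * T)) -> \bar R} := PQ \x PP.
apply: (@ge0_integral_half_lines_unique R _ T P (X i) G _ _ PQPP Z
  (fun q => G' q.1)) => //.
- by apply: measurableT_comp => //; exact: measurable_fst.
- by move=> x; rewrite -lhsE -rhsE.
- move=> x; rewrite -lhsE IH.
  apply: (integral_prod_bernoulli_lty (fun k b => M k b (replace_at g i _ k))) => k b.
  apply: order_stat_mean_ge0 => y; rewrite /replace_at; case: ifP => _.
    by rewrite ler0n.
  by have [_ + _] := tg k.
Qed.

(** Induction on the number [n] of coordinates whose function is arbitrary, the
    functions of index at least [n] being indicators of half-lines. *)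
Lemma integral_prod_mixture (g : 'I_d -> R -> R) :
  (forall k, measurable_fun setT (g k)) -> (forall k y, 0 <= g k y)%R ->
  (forall k, \int[P]_t (g k (X k t))%:E < +oo) ->
  \int[P]_t (\prod_k g k (X k t))%:E =
  \int[PQ]_w (\prod_k order_stat_mean k (I k w) (g k))%:E.
Proof.
move=> mg g0 goo.
suff H n : forall f : 'I_d -> R -> R, (forall k, tame k (f k)) ->
    (forall k : 'I_d, (n <= k)%N -> exists x, f k = \1_(`]-oo, x]%classic)) ->
    \int[P]_t (\prod_k f k (X k t))%:E = \int[PQ]_w (\prod_k M k (I k w) (f k))%:E.
  by apply: (H d) => [k|k]; [split|rewrite leqNgt ltn_ord].
elim: n => [f tf|n IHn f tf] hf.
  have /choice[x fx] : forall k, exists x, f k = \1_(`]-oo, x]%classic).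
    by move=> k; exact: hf.
  have -> : f = (fun k => \1_(`]-oo, x k]%classic)) by apply/funext.
  exact: mixture_half_lines.
have [nd|nd] := ltnP n d; last first.
  by apply: IHn => // k nk; have := ltn_ord k; rewrite ltnNge (leq_trans nd nk).
apply: (mixture_step (Ordinal nd)) => // x; apply: IHn => k.
  by rewrite /replace_at; case: ifP => // /eqP ->.
rewrite leq_eqVlt /replace_at => /predU1P[nk|nk]; last first.
  by case: ifP => [_|_]; [exists x|exact: hf].
by rewrite ifT; [exists x|apply/eqP/val_inj].
Qed.

End mixture.

(** * Moments of positive random variables *)

Lemma expectationE d (T : measurableType d) (R : realType) (P : probability T R)
    (f : T -> R) : 'E_P[f] = \int[P]_t (f t)%:E.
Proof. by rewrite unlock. Qed.

Lemma cdf_eq0_pos d (T : measurableType d) (R : realType) (P : probability T R)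
    (X : {RV P >-> R}) (x : R) :
  {ae P, forall t, (0 < X t)%R} -> (x <= 0)%R -> cdf X x = 0.
Proof.
move=> X_pos x0; rewrite /cdf /distribution /pushforward.
have mA : measurable (X @^-1` `]-oo, x]%classic) by exact: measurable_funPTI.
apply/negligibleP => //; apply: negligibleS X_pos => t /=.
rewrite in_itv/= => Xx /lt_le_trans/(_ Xx)/lt_le_trans/(_ x0).
by rewrite ltxx.
Qed.

Lemma cdf_eq0_ae_pos d (T : measurableType d) (R : realType) (P : probability T R)
    (X : {RV P >-> R}) :
  cdf X 0 = 0 -> {ae P, forall t, (0 < X t)%R}.
Proof.
move=> X0; exists (X @^-1` `]-oo, 0%R]%classic); split => //.
- exact: measurable_funPTI.
- by move=> t /= /negP; rewrite -leNgt in_itv/=.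
Qed.

Section positive_part_moments.
Context {R : realType}.

(** A random variable that is positive almost everywhere may take negative values;
    its powers are replaced by this function, nonnegative everywhere, without
    changing any expectation. *)
Definition pos_pow (n : nat) (y : R) : R := (Num.max y 0 ^+ n)%R.

Lemma pos_pow_ge0 n y : (0 <= pos_pow n y)%R.
Proof. by rewrite exprn_ge0// le_max lexx orbT. Qed.

Lemma measurable_pos_pow n : measurable_fun setT (pos_pow n).
Proof. by apply: measurable_funX; exact: measurable_maxr. Qed.

Context d (T : measurableType d) (P : probability T R) (X : {RV P >-> R}).
Hypothesis X_pos : {ae P, forall t, (0 < X t)%R}.

Let measurable_pos_pow_comp n : measurable_fun setT (fun t => (pos_pow n (X t))%:E).
Proof.
by apply/measurable_EFinP; apply: measurableT_comp => //; exact: measurable_pos_pow.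
Qed.

Lemma moment_pos_pow n : moment X n = \int[P]_t (pos_pow n (X t))%:E.
Proof.
rewrite /moment expectationE; apply: ae_eq_integral => //.
  by apply/measurable_EFinP; exact: measurable_funX.
by apply: filterS X_pos => t Xt _; rewrite /pos_pow max_l// ltW.
Qed.

(** Otherwise the nonnegative function [pos_pow n (X t)] would vanish almost
    everywhere, whereas it is positive on a set of probability one.  The moments
    of [X] can thus serve as denominators. *)
Lemma moment_pos n : 0 < moment X n.
Proof.
have i0 : 0 <= moment X n.
  by rewrite moment_pos_pow integral_ge0// => t _; rewrite lee_fin pos_pow_ge0.
rewrite lt_neqAle i0 andbT; apply/eqP => /esym; rewrite moment_pos_pow => I0.
have : \int[P]_t `|(pos_pow n (X t))%:E| = 0.
  by rewrite -[RHS]I0; apply: eq_integral => t _; rewrite gee0_abs// lee_fin pos_pow_ge0.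
move/ae_eq_integral_abs => /(_ measurableT (measurable_pos_pow_comp n)) X0.
have : {ae P, forall t, False}.
  apply: filterS2 X_pos X0 => t Xt /(_ Logic.I)/= /eqP.
  by rewrite eqe /pos_pow max_l ?expf_eq0 ?gt_eqF ?andbF// ltW.
move=> [A [mA A0 sA]]; have AT : A = setT.
  by apply/seteqP; split => // t _; apply: sA.
by move: A0; rewrite AT probability_setT => /eqP; rewrite onee_eq0.
Qed.

(** For [n <= m], [x^n <= 1 + x^m] when [x] is nonnegative. *)
Lemma moment_lty m n : (n <= m)%N ->
  P.-integrable setT (fun t => (X t ^+ m)%:E) -> moment X n < +oo.
Proof.
move=> nm /integrableP[_ Xm]; rewrite moment_pos_pow.
apply: (@le_lt_trans _ _ (\int[P]_t (1 + `|(X t ^+ m)%:E|))).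
  apply: ge0_le_integral => //.
  - by move=> t _; rewrite lee_fin pos_pow_ge0.
  - apply: emeasurable_funD => //; apply: measurableT_comp => //.
    by apply/measurable_EFinP; exact: measurable_funX.
  - move=> t _; rewrite abse_EFin -EFinD lee_fin normrX /pos_pow.
    apply: (@le_trans _ _ (`|X t| ^+ n))%R.
      by rewrite lerXn2r ?nnegrE ?le_max ?lexx ?orbT// ge_max ler_norm normr_ge0.
    have [x1|/ltW x1] := leP `|X t|%R 1%R.
      apply: (@le_trans _ _ 1%R); [exact: exprn_ile1|].
      by rewrite lerDl exprn_ge0.
    by rewrite (le_trans (ler_weXn2l x1 nm))// lerDr.
rewrite ge0_integralD//; last first.
  apply: measurableT_comp => //.
  by apply/measurable_EFinP; exact: measurable_funX.
by rewrite integral_cst//= probability_setT mule1 lte_add_pinfty// ltry.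
Qed.

End positive_part_moments.

Section max_moments.
Context {R : realType} {d} {T : measurableType d} {P : probability T R}.
Context {d2} {T2 : measurableType d2} {P2 : probability T2 R}.
Variables (X : {RV P >-> R}) (X2 : {RV P2 >-> R}).
Hypothesis X_pos : {ae P, forall t, (0 < X t)%R}.
Hypothesis X2_max : max_of_two_copies X X2.

(** [X2] and the maximum of two independent copies of [X] may live on different
    spaces, but they have the same cdf; in particular [X2] is positive almost
    everywhere, since its cdf vanishes at [0]. *)
Lemma moment_max_of_two_copies n :
  moment X2 n = \int[P \x P]_p (pos_pow n (order_stat X true p))%:E.
Proof.
have X2_pos : {ae P2, forall t, (0 < X2 t)%R}.
  by apply: cdf_eq0_ae_pos; rewrite X2_max cdf_eq0_pos// expe2 mule0.
rewrite moment_pos_pow//.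
pose PP : {measure set (T * T) -> \bar R} := P \x P.
have mo : measurable_fun setT (order_stat X true) by exact: measurable_order_stat.
have half x : \int[P2]_t (\1_(`]-oo, x]%classic) (X2 t) * cst 1 t)%:E = cdf X2 x.
  by rewrite -integral_half_line; apply: eq_integral => t _; rewrite mulr1.
transitivity (\int[P2]_t (pos_pow n (X2 t) * cst 1 t)%:E).
  by apply: eq_integral => t _; rewrite mulr1.
transitivity (\int[PP]_p (pos_pow n (order_stat X true p) * cst 1 p)%:E); last first.
  by apply: eq_integral => t _; rewrite mulr1.
apply: (@ge0_integral_half_lines_unique R _ T2 P2 X2 (cst 1%R) _ _ PP
  (order_stat X true) (cst 1%R)) => //.
- move=> x; rewrite half X2_max; under eq_integral do rewrite mulr1.
  by rewrite integral_order_stat_half_line /F_U EFin_expe fineK// fin_num_measure.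
- by move=> x; rewrite half (le_lt_trans (cdf_le1 _ _))// ltry.
- exact: measurable_pos_pow.
- by move=> y; exact: pos_pow_ge0.
Qed.

End max_moments.

(** * The moments of the sum *)

(** When some [x k] is negative, both sides vanish because [X k] is positive; this
    removes the sign restriction from the representation of the joint cdf. *)
Lemma cdf_represented (R : realType) (d : nat)
  (dT : measure_display) (T : measurableType dT) (P : probability T R)
  (X : 'I_d -> {RV P >-> R})
  (X_pos : forall k, {ae P, forall t, (0 < X k t)%R})
  (C : ('I_d -> R) -> R)
  (X_cdf : forall x : 'I_d -> R, (forall k, (0 <= x k)%R) ->
     P [set t | forall k, (X k t <= x k)%R]
     = (C (fun k => fine (cdf (X k) (x k))))%:E)
  (dQ : measure_display) (Q : measurableType dQ) (PQ : probability Q R)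
  (I : 'I_d -> {RV PQ >-> bool}) (I_repr : represents I C) (x : 'I_d -> R) :
  P [set t | forall k, (X k t <= x k)%R] =
  \int[PQ]_w (\prod_k F_U (I k w) (fine (cdf (X k) (x k))))%:E.
Proof.
have [x0|] := pselect (forall k, (0 <= x k)%R).
  rewrite X_cdf// I_repr ?expectationE// => k.
  rewrite fine_ge0 ?cdf_ge0//= -lee_fin fineK ?cdf_le1//.
  by rewrite fin_num_measure.
move=> /existsNP[k /negP]; rewrite -ltNge => xk.
have Fk0 : cdf (X k) (x k) = 0 by apply: cdf_eq0_pos => //; exact: ltW.
transitivity (0 : \bar R).
  apply: (@subset_measure0 _ _ _ P _ (X k @^-1` `]-oo, x k]%classic)) => //.
  - exact: measurable_orthant.
  - exact: measurable_funPTI.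
  - by move=> t /= /(_ k); rewrite in_itv.
apply/esym/integral0_eq => w _; rewrite (bigD1 k)//= Fk0/= /F_U.
by case: (I k w); rewrite ?subr0 ?expr1n ?subrr ?expr0n ?mul0r.
Qed.

(** The mixture formula with its factors identified: the means of the maximum and
    of the minimum are [mu] and [2 E - mu], where [E] and [mu] are the moments of
    [X k] and [X2 k], and both have the form [E (1 + (-1)^b (1 - mu / E))]. *)
Lemma integral_prod_pos_pow (R : realType) (d : nat)
  (dT : measure_display) (T : measurableType dT) (P : probability T R)
  (X : 'I_d -> {RV P >-> R})
  (X_pos : forall k, {ae P, forall t, (0 < X k t)%R})
  (dQ : measure_display) (Q : measurableType dQ) (PQ : probability Q R)
  (I : 'I_d -> {RV PQ >-> bool})
  (half_lines : forall x : 'I_d -> R,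
  P [set t | forall k, (X k t <= x k)%R] =
  \int[PQ]_w (\prod_k F_U (I k w) (fine (cdf (X k) (x k))))%:E)
  (dT2 : measure_display) (T2 : measurableType dT2) (P2 : probability T2 R)
  (X2 : 'I_d -> {RV P2 >-> R})
  (X2_max : forall k, max_of_two_copies (X k) (X2 k))
  (n : 'I_d -> nat) (X_int : forall k, moment (X k) (n k) < +oo) :
  \int[P]_t (\prod_k pos_pow (n k) (X k t))%:E =
  (\prod_k fine (moment (X k) (n k)))%:E * 'E_PQ[fun w => (\prod_k
        (1 + (-1) ^+ (I k w)
             * (1 - fine (moment (X2 k) (n k)) / fine (moment (X k) (n k)))))%R].
Proof.
have X_int' k : \int[P]_t (pos_pow (n k) (X k t))%:E < +oo.
  by rewrite -moment_pos_pow.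
pose M k b := order_stat_mean X k b (pos_pow (n k)).
have ME k b : (M k b)%:E = \int[P \x P]_p (pos_pow (n k) (order_stat (X k) b p))%:E.
  apply: order_stat_meanE => //; first exact: measurable_pos_pow.
  by move=> x; exact: pos_pow_ge0.
have M0 k b : (0 <= M k b)%R.
  by apply: order_stat_mean_ge0 => x; exact: pos_pow_ge0.
have momentE k : (fine (moment (X k) (n k)))%:E = moment (X k) (n k).
  by rewrite fineK// ge0_fin_numE// ltW// moment_pos.
have mu0 k : (0 < fine (moment (X k) (n k)))%R.
  by rewrite -lte_fin momentE moment_pos.
have muE k : (M k true + M k false = fine (moment (X k) (n k)) + fine (moment (X k) (n k)))%R.
  apply: EFin_inj; rewrite !EFinD !ME ge0_integral_order_stat//.
  - by rewrite momentE moment_pos_pow.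
  - exact: measurable_pos_pow.
  - by move=> y; exact: pos_pow_ge0.
have M1 k : M k true = fine (moment (X2 k) (n k)).
  by rewrite (moment_max_of_two_copies (X k))// -ME.
have factorE k b : (fine (moment (X k) (n k)) * (1 + (-1) ^+ (b : bool)
    * (1 - fine (moment (X2 k) (n k)) / fine (moment (X k) (n k)))) = M k b)%R.
  rewrite -M1; have := muE k; have := lt0r_neq0 (mu0 k).
  set u := fine _ => u0 e; case: b.
    by rewrite expr1; field.
  have -> : M k false = (u + u - M k true)%R by rewrite -e; ring.
  by rewrite expr0; field.
have factor0 k b : (0 <= 1 + (-1) ^+ (b : bool)
    * (1 - fine (moment (X2 k) (n k)) / fine (moment (X k) (n k))))%R.
  by rewrite -(pmulr_rge0 _ (mu0 k)) factorE.
rewrite (integral_prod_mixture X I half_lines (fun k => pos_pow (n k)))//; last 2 first.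
- by move=> k; exact: measurable_pos_pow.
- by move=> k y; exact: pos_pow_ge0.
rewrite expectationE -ge0_integralZl_EFin//; last 3 first.
- by move=> w _; rewrite lee_fin prodr_ge0.
- apply/measurable_EFinP.
  apply: (@measurable_prod_bernoulli _ _ _ _ _ I xpredT (fun k b => 1 + (-1) ^+ (b : bool)
    * (1 - fine (moment (X2 k) (n k)) / fine (moment (X k) (n k)))))%R.
- by rewrite prodr_ge0// => k _; exact: ltW.
apply: eq_integral => w _; rewrite -EFinM; congr EFin.
by rewrite -big_split/=; apply: eq_bigr => k _; rewrite factorE.
Qed.

Theorem theorem4 (R : realType) (d : nat) (hd : (2 <= d)%N)
  (dT : measure_display) (T : measurableType dT) (P : probability T R)
  (X : 'I_d -> {RV P >-> R})
  (X_pos : forall k, {ae P, forall t, (0 < X k t)%R})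
  (C : ('I_d -> R) -> R) (C_fgm : is_fgm_copula C)
  (X_cdf : forall x : 'I_d -> R, (forall k, (0 <= x k)%R) ->
     P [set t | forall k, (X k t <= x k)%R]
     = (C (fun k => fine (cdf (X k) (x k))))%:E)
  (dQ : measure_display) (Q : measurableType dQ) (PQ : probability Q R)
  (I : 'I_d -> {RV PQ >-> bool})
  (I_sym : symmetric_bernoulli I) (I_repr : represents I C)
  (dT2 : measure_display) (T2 : measurableType dT2) (P2 : probability T2 R)
  (X2 : 'I_d -> {RV P2 >-> R})
  (X2_max : forall k, max_of_two_copies (X k) (X2 k))
  (m : nat) (hm : (1 <= m)%N)
  (X_int : forall k, P.-integrable setT (fun t => (X k t ^+ m)%:E)) :
  'E_P[fun t => ((\sum_k X k t) ^+ m)%R] =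
  \sum_(j : {ffun 'I_d -> 'I_m.+1} | (\sum_k j k == m)%N)
    ((m`!%:R / \prod_k (j k)`!%:R)
       * \prod_k fine (moment (X k) (j k)))%:E
    * 'E_PQ[fun w => (\prod_k
        (1 + (-1) ^+ (I k w)
             * (1 - fine (moment (X2 k) (j k)) / fine (moment (X k) (j k)))))%R].
Proof.
have half_lines := cdf_represented _ _ _ _ _ _ X_pos _ X_cdf _ _ _ I I_repr.
pose c (j : {ffun 'I_d -> 'I_m.+1}) : R := (m`!%:R / \prod_k (j k)`!%:R)%R.
have c0 j : (0 <= c j)%R by rewrite divr_ge0// prodr_ge0.
have mprod (j : {ffun 'I_d -> 'I_m.+1}) :
    measurable_fun setT (fun t => (\prod_k pos_pow (j k) (X k t))%:E).
  apply/measurable_EFinP; apply: measurable_prodr_cond => k _.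
  by apply: measurableT_comp => //; exact: measurable_pos_pow.
have prod0 (j : {ffun 'I_d -> 'I_m.+1}) t : 0 <= (\prod_k pos_pow (j k) (X k t))%:E.
  by rewrite lee_fin prodr_ge0// => k _; exact: pos_pow_ge0.
rewrite expectationE.
(* with [pos_pow] all terms are nonnegative everywhere, so that the sum commutes
   with the integral *)
transitivity (\int[P]_t \sum_(j : {ffun 'I_d -> 'I_m.+1} | (\sum_k j k == m)%N)
    ((c j)%:E * (\prod_k pos_pow (j k) (X k t))%:E)).
  apply: ae_eq_integral => //.
  - apply/measurable_EFinP; apply: measurable_funX.
    by apply: measurable_sum.
  - under eq_fun do rewrite -big_filter.
    by apply: emeasurable_sum => j; exact: measurable_funeM.
  - have /filter_forall : forall k, \forall t \ae P, (0 < X k t)%R by [].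
    apply: filterS => t Xt _; rewrite exprn_sum_multinomial -sumEFin.
    apply: eq_bigr => j _; rewrite -EFinM; congr (_ * _)%:E.
    by apply: eq_bigr => k _; rewrite /pos_pow max_l// ltW.
under eq_integral do rewrite -big_filter.
rewrite ge0_integral_sum//; last 2 first.
- by move=> j; exact: measurable_funeM.
- by move=> j t _; rewrite mule_ge0// lee_fin.
rewrite big_filter; apply: eq_bigr => j _.
rewrite ge0_integralZl_EFin// -/(c j) [in RHS]EFinM -muleA; congr (_ * _).
apply: (integral_prod_pos_pow _ _ _ _ _ _ X_pos _ _ _ I half_lines _ _ _ X2
  X2_max (fun k => j k)) => k.
by apply: (@moment_lty _ _ _ _ _ (X_pos k) m); rewrite // -ltnS.
Qed.
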